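(* For every $d\ge 2$, $$\lim_{g\to\infty}\beta_{\mathrm{TF}_g}^d=\beta_{\mathrm{TSP}}^d .$$
   Context: Let $x_1,x_2,\dots$ be independent uniformly random points of $[0,1]^d$ and $\mathcal{X}_n=\{x_1,\dots,x_n\}$. All lengths are Euclidean. $\mathrm{TSP}(X)$ is the minimum length of a traveling salesperson tour (closed Hamiltonian cycle) through the finite set $X$. A 2-factor of $X$ is a collection of vertex-disjoint cycles (each with at least 3 vertices) covering all points of $X$. For $g\ge 3$, $\mathrm{TF}_g(X)$ is the minimum total length of a 2-factor of $X$ all of whose cycles have at least $g$ vertices (the covering requirement is imposed only when $|X|\ge g$). For $L\in\{\mathrm{TSP},\mathrm{TF}_g\}$, $\beta_L^d$ is the constant such that $L(\mathcal{X}_n)/n^{(d-1)/d}\to\beta_L^d$ almost surely (which exists). *)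

(* Defs.v *)
From HB Require Import structures.
From mathcomp Require Import all_boot all_order all_algebra.
From mathcomp Require Import finmap.
From mathcomp Require Import all_classical all_reals all_analysis.
Set Implicit Arguments.
Unset Strict Implicit.
Unset Printing Implicit Defensive.
Import Order.TTheory GRing.Theory Num.Theory.
Import numFieldNormedType.Exports.
Local Open Scope classical_set_scope.
Local Open Scope ring_scope.

Section Functionals.
Variables (R : realType) (d : nat).
Notation point := (d.-tuple R).

Definition eucl_dist (x y : point) : R :=
  Num.sqrt (\sum_(i < d) (tnth x i - tnth y i) ^+ 2).

(* A cycle is given by the sequence of its (pairwise distinct) vertices in the
   order of traversal; [next c x] is the vertex following [x], cyclically. *)
Definition cycle_length (c : seq point) : R :=
  \sum_(x <- c) eucl_dist x (next c x).

(* For at most two points the closed tour degenerates: its length is 0 for at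
   most one point and twice their distance for two points. *)
Definition is_tour (X : {fset point}) (c : seq point) : Prop :=
  uniq c /\ c =i X.

(* [inf] is here a minimum: the lengths form a nonempty finite set. *)
Definition TSP (X : {fset point}) : R :=
  inf [set cycle_length c | c in is_tour X].

Definition disjoint_cycles (X : {fset point}) (F : seq (seq point)) : Prop :=
  [/\ forall c, c \in F -> (3 <= size c)%N,
      uniq (flatten F) &
      {subset flatten F <= X}].

Definition covers (X : {fset point}) (F : seq (seq point)) : Prop :=
  {subset X <= flatten F}.

Definition two_factor (X : {fset point}) (F : seq (seq point)) : Prop :=
  disjoint_cycles X F /\ covers X F.

(* When [X] has fewer than [g] points covering is not required; the only
   admissible collection is then the empty one, and [TF g X] is 0. *)
Definition TF_admissible (g : nat) (X : {fset point}) (F : seq (seq point)) :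
    Prop :=
  [/\ disjoint_cycles X F,
      forall c, c \in F -> (g <= size c)%N &
      (g <= #|` X|)%N -> two_factor X F].

(* For [g >= 3] again a minimum over a nonempty finite set of lengths. *)
Definition TF (g : nat) (X : {fset point}) : R :=
  inf [set \sum_(c <- F) cycle_length c | F in TF_admissible g X].

End Functionals.

Section RandomPoints.
Context {disp : measure_display} {T : measurableType disp} {R : realType}.
Variables (P : probability T R) (d : nat).

Definition mutually_independent (x : nat -> {RV P >-> d.-tuple R}) : Prop :=
  forall (J : {fset nat}) (A : nat -> set (d.-tuple R)),
    (forall k, measurable (A k)) ->
    P (\bigcap_(k in [set` J]) (x k @^-1` A k)) =
    (\prod_(k <- J) P (x k @^-1` A k))%E.

(* The law of [x] is the [d]-fold product of the uniform law on [0, 1]; it is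
   determined by its values on measurable rectangles. *)
Definition uniform_on_cube (x : {RV P >-> d.-tuple R}) : Prop :=
  forall A : 'I_d -> set R, (forall i, measurable (A i)) ->
    P [set w | forall i, A i (tnth (x w) i)] =
    (\prod_(i < d) uniform_prob (@ltr01 R) (A i))%E.

Definition sample (x : nat -> {RV P >-> d.-tuple R}) (n : nat) (w : T) :
    {fset d.-tuple R} :=
  [fset x (val k) w | k in 'I_n]%fset.

Definition asymptotic_constant (x : nat -> {RV P >-> d.-tuple R})
    (L : {fset d.-tuple R} -> R) (beta : R) : Prop :=
  {ae P, forall w,
    (fun n : nat => L (sample x n w) / n%:R `^ ((d%:R - 1) / d%:R)) @ \oo
      --> beta}.

End RandomPoints.

(* Main.v *)
(** The comparison is deterministic. A tour through at least [g] points is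
    itself a 2-factor with cycles of length at least [g], so [TF g <= TSP].
    Conversely, a 2-factor of [n] points of the unit cube whose cycles all have
    at least [g] vertices has at most [n / g] cycles. As long as [m] cycles are
    left, two of them contain vertices at distance [O(m ^ (- 1 / d))], and
    splicing these two together costs twice that distance; summing over [m]
    gives a tour of extra length [O((n / g) ^ (1 - 1 / d))]. Dividing by
    [n ^ (1 - 1 / d)] and letting [n] tend to infinity at a single good outcome,
    [betaTSP - O(g ^ (- (1 - 1 / d))) <= betaTF g <= betaTSP]. *)
Require Import Defs.
From HB Require Import structures.
From mathcomp Require Import all_boot all_order all_algebra.
From mathcomp Require Import finmap.
From mathcomp Require Import all_classical all_reals all_analysis.
From mathcomp Require Import ring lra.
Import Order.TTheory GRing.Theory Num.Theory.
Import numFieldNormedType.Exports.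
Local Open Scope classical_set_scope.
Local Open Scope ring_scope.

(** This pays for one merge in the induction on the number of cycles. After clearing denominators it
    reads [(1 + 1/m) ^ r <= 1 + 1/(2m)], which follows from the case [r = 1/2] by squaring. *)
Lemma powR_concave_step (R : realType) (m : nat) (r : R) :
  (0 < m)%N -> 0 <= r <= 2^-1 ->
  m%:R `^ (1 - r) + 2^-1 * m.+1%:R `^ (- r) <= m.+1%:R `^ (1 - r).
Proof.
move=> m0 /andP[r0 r2]; have M0 : 0 < m%:R :> R by rewrite ltr0n.
rewrite !powRB ?pnatr_eq0 -?lt0n ?m0 ?implybT// powRN !powRr1//.
have s0 : 0 < m%:R `^ r by rewrite powR_gt0.
have t0 : 0 < m.+1%:R `^ r :> R by rewrite powR_gt0.
set s := _ `^ r in s0 *; set t := _ `^ r in t0 *.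
suff H : m%:R * t <= (m%:R + 2^-1) * s.
  have -> : m.+1%:R / t = 2^-1 * t^-1 + (m%:R + 2^-1) / t :> R.
    by rewrite -natr1; field; rewrite gt_eqF.
  by rewrite addrC lerD2l ler_pdivrMr// mulrAC ler_pdivlMr.
have q1 : 1 <= m.+1%:R / m%:R :> R by rewrite ler_pdivlMr// mul1r ler_nat.
have -> : t = (m.+1%:R / m%:R) `^ r * s.
  by rewrite -powRM ?divr_ge0// divfK// gt_eqF.
rewrite mulrA ler_wpM2r ?(ltW s0)//.
apply: (@le_trans _ _ (m%:R * (1 + (2 * m%:R)^-1))); last first.
  by rewrite le_eqVlt; apply/orP; left; apply/eqP; field; rewrite gt_eqF.
rewrite ler_wpM2l ?ler0n//; apply: (le_trans (ler_powR q1 r2)).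
rewrite powR12_sqrt ?(le_trans _ q1)//.
have i0 : 0 <= (2 * m%:R)^-1 :> R by rewrite invr_ge0 mulr_ge0.
rewrite -[leRHS]ger0_norm ?addr_ge0// -sqrtr_sqr ler_wsqrtr//.
have -> : m.+1%:R / m%:R = 1 + 2 * (2 * m%:R)^-1 :> R.
  by rewrite -natr1; field; rewrite gt_eqF.
by rewrite sqrrD expr1n mul1r mulr_natl lerDl sqr_ge0.
Qed.

(** * Euclidean distance and lengths of cycles *)

Section Distance.
Context {R : realType} {d : nat}.
Implicit Types x y z : d.-tuple R.

Lemma eucl_dist_ge0 x y : 0 <= eucl_dist x y.
Proof. exact: sqrtr_ge0. Qed.

Lemma eucl_distC x y : eucl_dist x y = eucl_dist y x.
Proof. by congr Num.sqrt; apply: eq_bigr => i _; rewrite -sqrrN opprB. Qed.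

(** Squaring reduces this to Cauchy-Schwarz, which comes from Lagrange's identity: the double sum of
    [(a i * b j - a j * b i) ^+ 2] is twice [A * B - (\sum_i a i * b i) ^+ 2]. *)
Lemma minkowski_sqrt (a b : 'I_d -> R) :
  Num.sqrt (\sum_i (a i + b i) ^+ 2) <=
  Num.sqrt (\sum_i a i ^+ 2) + Num.sqrt (\sum_i b i ^+ 2).
Proof.
have ss0 (c : 'I_d -> R) : 0 <= \sum_i c i ^+ 2.
  by apply: sumr_ge0 => i _; exact: sqr_ge0.
set A := \sum_i a i ^+ 2; set B := \sum_i b i ^+ 2.
have CS : (\sum_i a i * b i) ^+ 2 <= A * B.
  have : 0 <= \sum_i \sum_j (a i * b j - a j * b i) ^+ 2.
    by do 2! apply: sumr_ge0 => ? _; exact: sqr_ge0.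
  have -> : \sum_i \sum_j (a i * b j - a j * b i) ^+ 2 =
      \sum_i \sum_j a i ^+ 2 * b j ^+ 2 + \sum_i \sum_j a j ^+ 2 * b i ^+ 2
      - 2 * \sum_i \sum_j (a i * b i) * (a j * b j).
    rewrite mulr_sumr -big_split -sumrB; apply: eq_bigr => i _ /=.
    by rewrite mulr_sumr -big_split -sumrB; apply: eq_bigr => j _ /=; ring.
  rewrite [X in _ + X - _]exchange_big /=.
  rewrite -!big_distrlr /= -expr2 -/A -/B; lra.
rewrite -[leRHS]ger0_norm ?addr_ge0 ?sqrtr_ge0// -sqrtr_sqr ler_wsqrtr//.
rewrite sqrrD !sqr_sqrtr ?ss0// -mulr_natl -sqrtrM ?ss0//.
have : `|\sum_i a i * b i| <= Num.sqrt (A * B).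
  by rewrite -sqrtr_sqr ler_wsqrtr.
move=> /(le_trans (ler_norm _)) le_ab.
under eq_bigr do rewrite sqrrD -mulr_natl.
rewrite !big_split /= -mulr_sumr -/A -/B; lra.
Qed.

Lemma eucl_dist_triangle y x z : eucl_dist x z <= eucl_dist x y + eucl_dist y z.
Proof.
apply: le_trans (minkowski_sqrt _ _).
by rewrite ler_wsqrtr// ler_sum// => i _; rewrite addrA subrK.
Qed.

Fixpoint path_length x (p : seq (d.-tuple R)) : R :=
  if p is y :: p' then eucl_dist x y + path_length y p' else 0.

Lemma path_length_cat x p q :
  path_length x (p ++ q) = path_length x p + path_length (last x p) q.
Proof. by elim: p x => [|y p IH] x /=; rewrite ?add0r// IH addrA. Qed.

Lemma cycle_length_cons x p : uniq (x :: p) ->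
  cycle_length (x :: p) = path_length x (rcons p x).
Proof.
(* The closing vertex [z] is separated from the head [y]: the induction moves the head along while
   the closing vertex stays fixed. *)
suff H z y q : uniq (y :: q) ->
  \sum_(t <- y :: q) eucl_dist t (next_at t z y q) = path_length y (rcons q z).
  exact: H.
elim: q y => {x p} [|y p IH] x /=; first by rewrite big_seq1 eqxx addr0.
move=> /andP[xNyp uyp]; rewrite big_cons /= eqxx; congr (_ + _).
rewrite -IH// big_seq [RHS]big_seq; apply: eq_bigr => t typ.
by case: eqP => // tx; rewrite -tx typ in xNyp.
Qed.

Lemma cycle_length_ge0 (c : seq (d.-tuple R)) : 0 <= cycle_length c.
Proof. by apply: sumr_ge0 => ? _; exact: eucl_dist_ge0. Qed.

(** The two closing edges are replaced by edges from [last x p] to [y] and from [last y q] to [x];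
    by the triangle inequality each replacement costs at most [eucl_dist x y] more. *)
Lemma cycle_length_cat x p y q : uniq ((x :: p) ++ y :: q) ->
  cycle_length ((x :: p) ++ y :: q) <=
  cycle_length (x :: p) + cycle_length (y :: q) + 2 * eucl_dist x y.
Proof.
move=> u; have := u; rewrite cat_uniq => /and3P[up _ uq].
rewrite cat_cons in u *.
rewrite !cycle_length_cons// rcons_cat -!cats1 !path_length_cat /=.
rewrite !addr0.
have := eucl_dist_triangle x (last x p) y.
have := eucl_dist_triangle y (last y q) x.
rewrite (eucl_distC y x); lra.
Qed.

End Distance.

(** * Close pairs in the cube and the merging of cycles *)

Section Merging.
Context {R : realType} {d : nat}.
Notation point := (d.-tuple R).
Implicit Types (x : point) (F : seq (seq point)).

Definition in_cube x := forall i, 0 <= tnth x i <= 1.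

Lemma same_cell_dist (k : nat) x y (f : 'I_d -> nat) : (0 < k)%N ->
  (forall i, (f i)%:R <= k%:R * tnth x i <= (f i).+1%:R) ->
  (forall i, (f i)%:R <= k%:R * tnth y i <= (f i).+1%:R) ->
  eucl_dist x y <= Num.sqrt d%:R / k%:R.
Proof.
move=> k0 fx fy; have K0 : 0 < k%:R :> R by rewrite ltr0n.
rewrite -(ger0_norm (ltW K0)) -sqrtr_sqr -sqrtrV ?sqr_ge0// -sqrtrM ?ler0n//.
have -> : d%:R * (k%:R ^+ 2)^-1 = \sum_(i < d) (k%:R ^+ 2)^-1 :> R.
  by rewrite sumr_const card_ord mulr_natl.
rewrite ler_wsqrtr// ler_sum// => i _.
have := fx i; have := fy i; rewrite -natr1 => /andP[y0 y1] /andP[x0 x1].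
rewrite -exprVn -ler_sqrt ?sqr_ge0// !sqrtr_sqr.
rewrite [leRHS]ger0_norm ?invr_ge0 ?(ltW K0)//.
rewrite -[leRHS]mul1r ler_pdivlMr//.
rewrite -[X in _ * X <= _](ger0_norm (ltW K0)) -normrM.
rewrite ler_norml; lra.
Qed.

Lemma in_cube_cell (k : nat) x : (0 < k)%N -> in_cube x ->
  exists f : {ffun 'I_d -> 'I_k},
    forall i, (f i)%:R <= k%:R * tnth x i <= (f i).+1%:R.
Proof.
case: k => // k _ xc.
(* The minimum matters only for a coordinate equal to 1, where truncation gives [k.+1]; the cells
   are closed, so the last one still contains it. *)
exists [ffun i => inord (minn k (Num.truncn (k.+1%:R * tnth x i)))].
move=> i; have /andP[x0 x1] := xc i.
have z0 : 0 <= k.+1%:R * tnth x i by rewrite mulr_ge0.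
rewrite ffunE inordK ?ltnS ?geq_minl//.
have /andP[t0 /ltW t1] := truncn_itv z0.
rewrite /minn; case: ltnP => [kt|_]; last by rewrite t0 t1.
apply/andP; split; last by rewrite -[leRHS]mulr1 ler_wpM2l.
by rewrite (le_trans _ t0)// ler_nat ltnW.
Qed.

(* Pigeonhole on the grid of [k ^ d] cells, [k] maximal with [k ^ d < size s]. *)
Lemma close_pair (s : seq point) : (0 < d)%N -> (1 < size s)%N ->
  (forall x, x \in s -> in_cube x) ->
  exists i j, [/\ (i < j)%N, (j < size s)%N &
    forall x0, eucl_dist (nth x0 s i) (nth x0 s j) <=
      2 * Num.sqrt d%:R * (size s)%:R `^ (- d%:R^-1)].
Proof.
move=> d0 s2 sc; set n := size s in s2 *.
have ex_k : exists k, (k ^ d < n)%N by exists 1%N; rewrite exp1n.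
have ub_k k : (k ^ d < n)%N -> (k <= n)%N.
  move=> /ltnW; apply: leq_trans; case: k => // k.
  by rewrite -{1}(expn1 k.+1) leq_pexp2l.
case: (ex_maxnP ex_k ub_k) => k kn kmax.
have k0 : (0 < k)%N by apply: kmax; rewrite exp1n.
have nk : (n <= k.+1 ^ d)%N.
  by rewrite leqNgt; apply/negP => /kmax; rewrite ltnn.
have z : point := [tuple 0 | i < d].
have cell (i : 'I_n) : {f : {ffun 'I_d -> 'I_k} |
    forall l, (f l)%:R <= k%:R * tnth (nth z s i) l <= (f l).+1%:R}.
  by apply: cid; apply: in_cube_cell => //; apply/sc/mem_nth.
have /injectivePn[i [j ij fij]] : ~~ injectiveb (fun i => sval (cell i)).
  apply/injectiveP => /leq_card; rewrite card_ffun !card_ord leqNgt.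
  by rewrite kn.
have Dij : eucl_dist (nth z s i) (nth z s j) <=
    2 * Num.sqrt d%:R * n%:R `^ (- d%:R^-1).
  have := svalP (cell i); have := svalP (cell j); rewrite -fij => fj fi.
  apply: le_trans (same_cell_dist k _ _ (fun l => sval (cell i) l) k0 fi fj) _.
  rewrite mulrAC mulrC ler_wpM2r ?sqrtr_ge0//.
  have N0 : 0 < n%:R `^ d%:R^-1 :> R by rewrite powR_gt0// ltr0n ltnW.
  rewrite powRN -ler_pdivrMl// -invfM lef_pV2 ?posrE ?mulr_gt0 ?ltr0n//.
  (* Source of the factor 2: by maximality of [k], [n <= k.+1 ^ d <= (2 * k) ^ d]. *)
  apply: (@le_trans _ _ (((2 * k)%:R ^+ d) `^ d%:R^-1)).
    rewrite ge0_ler_powR ?invr_ge0 ?nnegrE ?exprn_ge0// -natrX ler_nat.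
    by rewrite (leq_trans nk)// leq_exp2r// mul2n -addnn -addn1 leq_add2l.
  rewrite -powR_mulrn// -powRrM divff ?pnatr_eq0 -?lt0n//.
  by rewrite powRr1// natrM.
have {}Dij x0 : eucl_dist (nth x0 s i) (nth x0 s j) <=
    2 * Num.sqrt d%:R * n%:R `^ (- d%:R^-1).
  by rewrite (set_nth_default z)// [nth x0 s j](set_nth_default z).
case: (ltngtP i j) => [lij|lji|/ord_inj eij]; last by rewrite eij eqxx in ij.
- by exists i, j; split.
- by exists j, i; split=> // x0; rewrite eucl_distC.
Qed.

(* Two cycles are merged at their first vertices [x] and [y] at an extra cost of
   at most [2 * |x - y|], and among [m] cycles some pair satisfies
   [|x - y| <= 2 * sqrt d / m ^ (1 / d)]. *)
Lemma merge_cycles F : (1 < d)%N -> uniq (flatten F) -> [::] \notin F ->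
  (forall x, x \in flatten F -> in_cube x) ->
  exists2 c, perm_eq c (flatten F) & cycle_length c <=
    \sum_(c <- F) cycle_length c +
    8 * Num.sqrt d%:R * (size F)%:R `^ (1 - d%:R^-1).
Proof.
move=> d1; have d0 : (0 < d)%N := ltnW d1.
have [n] := ubnP (size F); elim: n F => // n IH.
case => [|c1 [|c2 F]].
- move=> _ _ _ _; exists [::] => //.
  by rewrite {1}/cycle_length !big_nil add0r !mulr_ge0 ?sqrtr_ge0 ?powR_ge0.
- move=> _ _ _ _; exists c1; rewrite /= ?cats0//.
  by rewrite big_seq1 lerDl !mulr_ge0 ?sqrtr_ge0 ?powR_ge0.
have : (1 < size [:: c1, c2 & F])%N by [].
move: [:: c1, c2 & F] => {c1 c2}G G2; rewrite ltnS => leGn uG G0 Gc.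
have z : point := [tuple 0 | i < d].
set hds := [seq head z c | c <- G].
have shds : size hds = size G := size_map _ _.
have hdsc x : x \in hds -> in_cube x.
  move=> /mapP[[|y c] cG -> /=]; first by rewrite cG in G0.
  by apply: Gc; apply/flattenP; exists (y :: c); rewrite ?mem_head.
have hds2 : (1 < size hds)%N by rewrite shds.
have [i [j [ij]]] := close_pair hds d0 hds2 hdsc.
rewrite shds => jG /(_ z); have iG := ltn_trans ij jG.
rewrite !(nth_map [::])//; set ci := nth _ G i; set cj := nth _ G j => Dij.
have [H GH] : exists H, perm_eq G [:: ci, cj & H].
  (* As [i < j], [cj] is found strictly after position [i], so removing it from the tail [D] leaves
     the chosen [ci] alone. *)
  set D := drop i.+1 G; have cjD : cj \in D.
    rewrite /cj -(subnKC ij) -nth_drop mem_nth// size_drop ltn_sub2r//.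
    exact: leq_ltn_trans ij _.
  exists (take i G ++ rem cj D).
  rewrite -[X in perm_eq X](cat_take_drop i) (drop_nth [::])// -/ci -/D.
  rewrite -(cat1s ci D) perm_catCA perm_cons.
  rewrite perm_sym -cat1s perm_catCA perm_cat2l perm_sym; exact: perm_to_rem.
have sGH := perm_size GH; have fGH := perm_flatten GH.
have uGH : uniq (flatten [:: ci, cj & H]) by rewrite -(perm_uniq fGH).
have : [::] \notin [:: ci, cj & H] by rewrite -(perm_mem GH).
rewrite !inE !negb_or => /and3P[ci0 cj0 H0].
(* The concatenation counts as a single cycle, so the list is one shorter. *)
have [|||x|c cH Lc] := IH ((ci ++ cj) :: H).
- by rewrite (leq_trans _ leGn)// sGH.
- by rewrite /= -catA.
- by rewrite inE negb_or H0 andbT; case: (ci) ci0.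
- by rewrite /= -catA -(perm_mem fGH); exact: Gc.
exists c; first by rewrite (perm_trans cH)// perm_sym (perm_trans fGH)//= catA.
apply: (le_trans Lc); rewrite (perm_big _ GH) /= !big_cons sGH /=.
have LC : cycle_length (ci ++ cj) <= cycle_length ci + cycle_length cj +
    2 * eucl_dist (head z ci) (head z cj).
  move: uGH ci0 cj0; rewrite /= catA cat_uniq => /and3P[+ _ _].
  by case: (ci) (cj) => // x p [//|y q] u _ _; exact: cycle_length_cat.
have r01 : 0 <= (d%:R^-1 : R) <= 2^-1.
  by rewrite invr_ge0 ler0n/= lef_pV2 ?posrE ?ltr0n// ler_nat.
(* With [m] cycles the merge costs at most [4 * sqrt d * m ^ (- 1 / d)]; the constant 8 absorbs the
   factor 1/2 of the concavity step, whose bound on the exponent is where [d >= 2] enters. *)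
have := powR_concave_step R (size H).+1 _ isT r01.
rewrite sGH /= in Dij; set E := _ `^ (- _) in Dij * => step.
have sd0 : 0 <= 8 * Num.sqrt d%:R :> R by rewrite mulr_ge0 ?sqrtr_ge0.
have := ler_wpM2l sd0 step; lra.
Qed.

End Merging.

(** * Two-sided comparison of [TSP] and [TF g] *)

Section TourTwoFactor.
Context {R : realType} {d : nat}.
Notation point := (d.-tuple R).
Implicit Types (X : {fset point}) (F : seq (seq point)).

Lemma TSP_le_tour X c : is_tour X c -> TSP X <= cycle_length c.
Proof.
move=> cX; apply: ge_inf; last by exists c.
by exists 0 => _ [c' _ <-]; exact: cycle_length_ge0.
Qed.

Lemma is_tour_enum X : is_tour X X.
Proof. by split=> //; exact: fset_uniq. Qed.

Lemma TF_le_TSP (g : nat) X : (3 <= g)%N -> TF g X <= TSP X.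
Proof.
move=> g3; apply: lb_le_inf.
  by exists (cycle_length X), X => //; exact: is_tour_enum.
move=> _ [c [uc cX] <-].
have sc : size c = #|` X| by apply/perm_size/uniq_perm => //; exact: fset_uniq.
have lbTF : has_lbound
    [set \sum_(c <- F) cycle_length c | F in TF_admissible g X].
  by exists 0 => _ [F _ <-]; apply: sumr_ge0 => ? _; exact: cycle_length_ge0.
(* With at least [g] points the tour is an admissible one-cycle collection; with fewer, the empty
   collection of length 0 is admissible. *)
have [gX|Xg] := leqP g #|` X|.
- apply: ge_inf => //; exists [:: c]; last by rewrite big_seq1.
  have dc : disjoint_cycles X [:: c].
    split=> /= [c'|/[!cats0]//|x /[!cats0]]; last by rewrite cX.
    by rewrite inE => /eqP ->; rewrite sc (leq_trans g3).
  split=> // [c'|_]; first by rewrite inE => /eqP ->; rewrite sc.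
  by split=> // x; rewrite /= cats0 cX.
- apply: le_trans (cycle_length_ge0 c); apply: ge_inf => //.
  exists [::]; last by rewrite big_nil.
  by split=> // gX; rewrite leqNgt Xg in gX.
Qed.

(** The pieces need only be nonempty, so this serves both a genuine 2-factor and a family of
    singletons. *)
Lemma TSP_le_merge (q : R) F X : (1 < d)%N -> uniq (flatten F) ->
  [::] \notin F -> flatten F =i X -> {in X, forall x, in_cube x} ->
  (size F)%:R <= q ->
  TSP X <= \sum_(c <- F) cycle_length c +
    8 * Num.sqrt d%:R * q `^ (1 - d%:R^-1).
Proof.
move=> d1 uF F0 FX Xc Fq; have [|c cF Lc] := merge_cycles F d1 uF F0.
  by move=> x; rewrite FX; exact: Xc.
apply: le_trans (TSP_le_tour X c _) _.
  by split; [rewrite (perm_uniq cF)|move=> x; rewrite (perm_mem cF)].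
apply: (le_trans Lc); rewrite lerD2l ler_wpM2l ?mulr_ge0 ?sqrtr_ge0//.
rewrite ge0_ler_powR ?nnegrE ?(le_trans _ Fq)//.
by rewrite subr_ge0 invf_le1 ?ler1n ?ltr0n ltnW.
Qed.

(* The requirement [g ^ 2 <= n] takes care of the sets of fewer than [g] points,
   where [TF g] vanishes: they are joined up as at most [g <= n / g]
   singletons. *)
Lemma TSP_le_TF (g n : nat) X : (1 < d)%N -> (3 <= g)%N ->
  {in X, forall x, in_cube x} -> (#|` X| <= n)%N -> (g ^ 2 <= n)%N ->
  TSP X <= TF g X + 8 * Num.sqrt d%:R * (n%:R / g%:R) `^ (1 - d%:R^-1).
Proof.
move=> d1 g3 Xc Xn gn; have g0 : (0 < g)%N by exact: leq_trans g3.
rewrite -lerBlDr; apply: lb_le_inf.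
  (* The infimum is bounded below through all admissible collections, which requires that one
     exists: a single cycle through [X], or the empty collection. *)
  have [gX|Xg] := leqP g #|` X|.
    exists (cycle_length X + 0), [:: X : seq _]; last first.
      by rewrite big_cons big_nil.
    have dX : disjoint_cycles X [:: X : seq _].
      split=> /= [c|/[!cats0]|x /[!cats0]//]; last exact: fset_uniq.
      by rewrite inE => /eqP ->; exact: leq_trans gX.
    split=> // [c|_]; first by rewrite inE => /eqP ->.
    by split=> // x; rewrite /= cats0.
  exists 0, [::]; last by rewrite big_nil.
  by split=> // gX; rewrite leqNgt Xg in gX.
move=> _ [F [dF gF cF] <-]; rewrite lerBlDr.
have [gX|Xg] := leqP g #|` X|.
- have [{}dF XF] := cF gX; case: dF => F3 uF FX.
  apply: TSP_le_merge => //; first by apply/negP => /F3.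
    by move=> x; apply/idP/idP => [/FX|/XF].
  (* Counting vertices: [size F * g <= size (flatten F) <= #|X| <= n]. *)
  rewrite ler_pdivlMr ?ltr0n// -natrM ler_nat (leq_trans _ Xn)//.
  apply: leq_trans (uniq_leq_size uF FX); rewrite size_flatten.
  elim: F gF {F3 uF FX XF cF} => //= c F IH gF.
  rewrite mulSn leq_add ?gF ?mem_head// IH// => c' c'F.
  by rewrite gF// inE c'F orbT.
- set F1 := [seq [:: x] | x <- X].
  have fX : flatten F1 = X by rewrite /F1; elim: (X : seq _) => //= x s ->.
  apply: le_trans (TSP_le_merge (n%:R / g%:R) F1 X _ _ _ _ _ _) _ => //.
  + by rewrite fX fset_uniq.
  + by apply/negP => /mapP[].
  + by rewrite fX.
  + rewrite size_map ler_pdivlMr ?ltr0n// -natrM ler_nat (leq_trans _ gn)//.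
    by rewrite -mulnn leq_mul2r ltnW ?orbT.
  rewrite lerD2r big_map big1 ?sumr_ge0// => [? _|x _].
    exact: cycle_length_ge0.
  rewrite cycle_length_cons//= addr0 /eucl_dist big1 ?sqrtr0// => i _.
  by rewrite subrr expr0n.
Qed.

End TourTwoFactor.

(** * Almost sure containment in the cube and passage to the limit *)

Lemma ae_in_cube (R : realType) (disp : measure_display)
    (T : measurableType disp) (P : probability T R) (d : nat)
    (x : {RV P >-> d.-tuple R}) :
  uniform_on_cube x -> {ae P, forall w, in_cube (x w)}.
Proof.
move=> ux; have mE : measurable [set w | in_cube (x w)].
  rewrite (_ : [set w | in_cube (x w)] =
    \bigcap_(i in [set: 'I_d]) ((fun w => tnth (x w) i) @^-1` `[0, 1])).
    apply: fin_bigcap_measurable => // i _; rewrite -[X in measurable X]setTI.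
    apply: (measurableT_comp (measurable_tnth i) (measurable_funPT x)) => //.
  apply/seteqP; split=> w /= xw i; first by move=> _ /=; rewrite in_itv /= xw.
  by have := xw i I; rewrite /= in_itv.
have PE : P [set w | in_cube (x w)] = 1%E.
  have -> : [set w | in_cube (x w)] =
      [set w | forall i, [set` `[0 : R, 1]] (tnth (x w) i)].
    by apply/seteqP; split=> w /= xw i; have := xw i; rewrite /= in_itv.
  (* Each factor of the product is the total mass 1 of the uniform density. *)
  rewrite (ux (fun=> [set` `[0, 1]]))//; apply: big1 => i _.
  exact: integral_uniform_pdf1.
exists (~` [set w | in_cube (x w)]); split=> //; first exact: measurableC.
by rewrite probability_setC// PE subee.
Qed.

Lemma cvg_natr_powRN (R : realType) (a : R) :
  0 < a -> (n%:R : R) `^ (- a) @[n --> \oo] --> (0 : R).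
Proof.
move=> a0; apply/cvgrPdist_le => e e0; near=> n.
rewrite sub0r normrN ger0_norm ?powR_ge0//.
(* This threshold solves [n ^ (- a) = e]. *)
have en : e `^ (- a^-1) <= n%:R by near: n; exact: nbhs_infty_ger.
have n0 : 0 < n%:R :> R by apply: lt_le_trans en; exact: powR_gt0.
rewrite powRN -[leRHS]invrK lef_pV2 ?posrE ?invr_gt0 ?powR_gt0//.
have -> : e^-1 = (e `^ (- a^-1)) `^ a.
  by rewrite -powRrM mulNr mulVf ?gt_eqF// powR_inv1// ltW.
by rewrite ge0_ler_powR ?nnegrE ?powR_ge0// ltW.
Unshelve. all: end_near. Qed.

Theorem theorem1p4 (R : realType) (disp : measure_display)
    (T : measurableType disp) (P : probability T R) (d : nat)
    (x : nat -> {RV P >-> d.-tuple R})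
    (betaTF : nat -> R) (betaTSP : R)
    (hd : (2 <= d)%N)
    (hindep : mutually_independent x)
    (hunif : forall k : nat, uniform_on_cube (x k))
    (hTF : forall g : nat, (3 <= g)%N ->
      asymptotic_constant x (@TF R d g) (betaTF g))
    (hTSP : asymptotic_constant x (@TSP R d) betaTSP) :
  betaTF g @[g --> \oo] --> betaTSP.
Proof.
have d0 : d%:R != 0 :> R by rewrite pnatr_eq0 -lt0n ltnW.
have expE : (d%:R - 1) / d%:R = 1 - d%:R^-1 :> R.
  by rewrite mulrBl divff// mul1r.
have a0 : 0 < 1 - d%:R^-1 :> R.
  by rewrite subr_gt0 invf_lt1 ?ltr1n ?ltr0n// ltnW.
(* Countably many null sets are discarded, so that one outcome serves all [g] at once. *)
have aeTF : {ae P, forall w, forall g, (3 <= g)%N ->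
    TF g (sample x n w) / n%:R `^ ((d%:R - 1) / d%:R) @[n --> \oo]
      --> betaTF g}.
  apply/ae_foralln => g; case: (leqP 3 g) => [g3|_]; last exact: aeW.
  by apply: filterS (hTF g g3).
have aeC : {ae P, forall w, forall k, in_cube (x k w)}.
  by apply/ae_foralln => k; exact: ae_in_cube.
(* An almost sure event of a probability space is nonempty; everything after this is
   deterministic. *)
have [w [wTF [wTSP wC]]] : exists w,
    (forall g, (3 <= g)%N ->
      TF g (sample x n w) / n%:R `^ ((d%:R - 1) / d%:R) @[n --> \oo]
        --> betaTF g) /\
    TSP (sample x n w) / n%:R `^ ((d%:R - 1) / d%:R) @[n --> \oo]
      --> betaTSP /\
    forall k, in_cube (x k w).
  have [|w [? [? ?]]] := @filter_ex _ _ (ae_properfilter_algebraOfSetsType _)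
      _ (filterI aeTF (filterI hTSP aeC)).
    by rewrite /= probability_setT lte01.
  by exists w.
have sC n : {in sample x n w, forall y, in_cube y}.
  by move=> y /imfsetP[k _ ->]; exact: wC.
(* Only an inequality, since sample points may coincide at [w]. *)
have sn n : (#|` sample x n w| <= n)%N.
  apply: leq_trans (leq_imfset_card _ _ _) _.
  by rewrite size_enum_ord.
set K : R := 8 * Num.sqrt d%:R.
have lbTSP : betaTSP - K * g%:R `^ (- (1 - d%:R^-1)) @[g --> \oo] --> betaTSP.
  rewrite -[X in _ --> X](subr0 betaTSP) -(mulr0 K).
  apply: cvgB; first exact: cvg_cst.
  by apply: cvgM; [exact: cvg_cst|exact: cvg_natr_powRN].
apply: (squeeze_cvgr _ lbTSP (cvg_cst betaTSP)); near=> g.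
have g3 : (3 <= g)%N by near: g; exact: nbhs_infty_ge.
have g0 : 0 < g%:R :> R by rewrite ltr0n (leq_trans _ g3).
apply/andP; split; last first.
  apply: ler_cvg_to (wTF g g3) wTSP _; near=> n.
  by rewrite ler_wpM2r ?invr_ge0 ?powR_ge0// TF_le_TSP.
rewrite lerBlDr.
(* Here [g] is fixed and [n] grows, so [g ^ 2 <= n] holds eventually; after division by
   [n ^ (1 - 1 / d)] the error no longer depends on [n]. *)
apply: (ler_cvg_to wTSP (cvgD (wTF g g3) (cvg_cst _))); near=> n.
have gn : (g ^ 2 <= n)%N by near: n; exact: nbhs_infty_ge.
have n0 : 0 < n%:R :> R.
  by rewrite ltr0n (leq_trans _ gn)// expn_gt0 (leq_trans _ g3).
have := TSP_le_TF g n _ hd g3 (sC n) (sn n) gn.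
rewrite -/K -powR_inv1 ?(ltW g0)// powRM ?powR_ge0 ?(ltW n0)// -powRrM mulN1r.
rewrite /= expE ler_pdivrMr ?powR_gt0// mulrDl divfK ?gt_eqF ?powR_gt0//.
by move=> le_TSP; rewrite -mulrA (mulrC (_ `^ - _)).
Unshelve. all: end_near. Qed.
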